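(* Let $n\in\mathbb{Z}$ and let $\rho:\pi_n\to\mathrm{SL}_2(\mathbb{C})$ be an irreducible representation of the group of the twist knot $J(2,2n)$. Then $\operatorname{tr}\rho(a)=\operatorname{tr}\rho(ab)$ holds (i.e. the conjugacy class of $\rho$ is on the line $x=y$) if and only if $\rho$ factors through the natural surjection $\pi_n\twoheadrightarrow\pi_1(M_{-3})$, where $M_{-3}$ is the result of the $(-3)$-Dehn surgery along $J(2,2n)$.
   Context: The group of the twist knot $J(2,2n)$ is $\pi_n=\langle a,b\mid aw^n=w^nb\rangle$ with $w=[a,b^{-1}]=ab^{-1}a^{-1}b$. Put $x=\operatorname{tr}\rho(a)$, $y=\operatorname{tr}\rho(ab)$. With $\overline{w}=ba^{-1}b^{-1}a$, the preferred longitude corresponding to the meridian $a$ is $\lambda_a=\overline{w}^{\,n}w^n$, and the fundamental group of the result $M_{-3}$ of $(-3)$-Dehn surgery along $J(2,2n)$ is $\pi_1(M_{-3})=\langle a,b\mid aw^n=w^nb,\ a^{-3}\,\overline{w}^{\,n}w^{n}=1\rangle$.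
   Formalization: The longitude of the meridian a is taken as w^n wbar^n instead of the displayed wbar^n w^n, which commutes with b rather than a; with the displayed relation a^{-3} wbar^n w^n = 1 the claim fails, e.g. for n = -1 at x = y = 1 + sqrt 2. *)

(* Defs.v *)
From HB Require Import structures.
From mathcomp Require Import all_boot all_order all_algebra.
From mathcomp Require Import boolp reals complex.

Set Implicit Arguments.
Unset Strict Implicit.
Unset Printing Implicit Defensive.

Import Order.TTheory GRing.Theory Num.Theory.

Local Open Scope quotient_scope.

Section Words.
Variable X : choiceType.

(* The letter (x, false) stands for x, the letter (x, true) for x^-1. *)
Definition word : Type := seq (X * bool).
HB.instance Definition _ := Choice.on word.

Definition wgen (x : X) : word := [:: (x, false)].

Definition winv (u : word) : word := rev [seq (l.1, ~~ l.2) | l <- u].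

Definition wexp (u : word) (n : int) : word :=
  match n with
  | Posz k => flatten (nseq k u)
  | Negz k => flatten (nseq k.+1 (winv u))
  end.

End Words.

Section Presentation.
Variables (X : choiceType) (R : seq (word X * word X)).

(* A pair (u, v) in R is the defining relation u = v. *)
Inductive pres_eq : word X -> word X -> Prop :=
| pres_eq_refl u : pres_eq u u
| pres_eq_sym u v : pres_eq u v -> pres_eq v u
| pres_eq_trans v u t : pres_eq u v -> pres_eq v t -> pres_eq u t
| pres_eq_cat u u' v v' : pres_eq u u' -> pres_eq v v' ->
    pres_eq (u ++ v) (u' ++ v')
| pres_eq_cancel x e : pres_eq [:: (x, e); (x, ~~ e)] [::]
| pres_eq_rel r : r \in R -> pres_eq r.1 r.2.

Definition pres_eqb (u v : word X) : bool := `[< pres_eq u v >].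

Lemma pres_eqb_refl : reflexive pres_eqb.
Proof. by move=> u; apply/asboolP; apply: pres_eq_refl. Qed.

Lemma pres_eqb_sym : symmetric pres_eqb.
Proof. by move=> u v; apply/asboolP/asboolP; apply: pres_eq_sym. Qed.

Lemma pres_eqb_trans : transitive pres_eqb.
Proof.
move=> v u t /asboolP uv /asboolP vt; apply/asboolP.
exact: pres_eq_trans uv vt.
Qed.

Canonical pres_equiv :=
  EquivRel pres_eqb pres_eqb_refl pres_eqb_sym pres_eqb_trans.

(* The group presented by < X | R >. *)
Definition pres_group : Type := {eq_quot pres_equiv}.
HB.instance Definition _ := Choice.on pres_group.

Definition pres_word (u : word X) : pres_group := \pi_{eq_quot pres_equiv} u.

Definition pres_repr (g : pres_group) : word X :=
  repr (g : {eq_quot pres_equiv}).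

Lemma pres_wordP u v : pres_word u = pres_word v <-> pres_eq u v.
Proof.
split; first by move/eqmodP/asboolP.
by move=> uv; apply/eqmodP/asboolP.
Qed.

Lemma pres_reprK g : pres_word (pres_repr g) = g.
Proof. exact: reprK. Qed.

Lemma pres_repr_word u : pres_eq (pres_repr (pres_word u)) u.
Proof. by apply/pres_wordP; rewrite pres_reprK. Qed.

Lemma pres_eq_mulVw u : pres_eq (winv u ++ u) [::].
Proof.
elim: u => [|[y f] u IH] /=; first exact: pres_eq_refl.
rewrite /winv /= rev_cons -cats1 -catA /=.
have h := pres_eq_cat (pres_eq_cancel y (~~ f)) (pres_eq_refl u).
rewrite negbK /= in h.
exact: pres_eq_trans (pres_eq_cat (pres_eq_refl _) h) IH.
Qed.

Lemma winvK : involutive (@winv X).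
Proof.
move=> u; rewrite /winv map_rev revK -map_comp.
by rewrite (@eq_map _ _ _ id) ?map_id // => -[y f] /=; rewrite negbK.
Qed.

Lemma pres_eq_mulwV u : pres_eq (u ++ winv u) [::].
Proof. by have := pres_eq_mulVw (winv u); rewrite winvK. Qed.

Lemma pres_eq_winv u v : pres_eq u v -> pres_eq (winv u) (winv v).
Proof.
elim=> {u v} [u|u v _ IH|v u t _ IH1 _ IH2|u u' v v' _ IH1 _ IH2|x e|r rR].
- exact: pres_eq_refl.
- exact: pres_eq_sym.
- exact: pres_eq_trans IH1 IH2.
- by rewrite /winv !map_cat !rev_cat; apply: pres_eq_cat.
- rewrite /winv /= /rev /= negbK.
  exact: pres_eq_cancel.
- have h1 := pres_eq_cat (pres_eq_refl (winv r.1))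
    (pres_eq_cat (pres_eq_rel rR) (pres_eq_refl (winv r.2))).
  have h2 := pres_eq_cat (pres_eq_mulVw r.1) (pres_eq_refl (winv r.2)).
  have h3 := pres_eq_cat (pres_eq_refl (winv r.1)) (pres_eq_mulwV r.2).
  rewrite -catA in h2; rewrite cats0 in h3.
  exact: pres_eq_trans (pres_eq_trans (pres_eq_sym h3) (pres_eq_sym h1)) h2.
Qed.

Definition pres_one : pres_group := pres_word [::].
Definition pres_mul (g h : pres_group) : pres_group :=
  pres_word (pres_repr g ++ pres_repr h).
Definition pres_inv (g : pres_group) : pres_group :=
  pres_word (winv (pres_repr g)).

Lemma pres_mulE u v :
  pres_mul (pres_word u) (pres_word v) = pres_word (u ++ v).
Proof. by apply/pres_wordP/pres_eq_cat; apply: pres_repr_word. Qed.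

Lemma pres_invE u : pres_inv (pres_word u) = pres_word (winv u).
Proof. by apply/pres_wordP/pres_eq_winv/pres_repr_word. Qed.

Lemma pres_mulA : associative pres_mul.
Proof.
move=> g h k; rewrite -(pres_reprK g) -(pres_reprK h) -(pres_reprK k).
by rewrite !pres_mulE catA.
Qed.

Lemma pres_mul1 : left_id pres_one pres_mul.
Proof. by move=> g; rewrite -(pres_reprK g) pres_mulE. Qed.

Lemma pres_mulr1 : right_id pres_one pres_mul.
Proof. by move=> g; rewrite -(pres_reprK g) pres_mulE cats0. Qed.

Lemma pres_mulV : left_inverse pres_one pres_inv pres_mul.
Proof.
move=> g; rewrite -(pres_reprK g) pres_invE pres_mulE.
exact/pres_wordP/pres_eq_mulVw.
Qed.

Lemma pres_mulrV : right_inverse pres_one pres_inv pres_mul.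
Proof.
move=> g; rewrite -(pres_reprK g) pres_invE pres_mulE.
exact/pres_wordP/pres_eq_mulwV.
Qed.

HB.instance Definition _ := isGroup.Build pres_group
  pres_mulA pres_mul1 pres_mulr1 pres_mulV pres_mulrV.

Lemma pres_wordM u v : pres_word (u ++ v) = (pres_word u * pres_word v)%g.
Proof. by rewrite -pres_mulE. Qed.

Lemma pres_wordV u : pres_word (winv u) = ((pres_word u)^-1)%g.
Proof. by rewrite -pres_invE. Qed.

Lemma pres_word_exp u n : pres_word (wexp u n) =
  match n with
  | Posz k => (pres_word u ^+ k)%g
  | Negz k => (pres_word u ^- k.+1)%g
  end.
Proof.
have nat_exp t k : pres_word (flatten (nseq k t)) = (pres_word t ^+ k)%g.
  by elim: k => //= k IH; rewrite pres_wordM IH expgS.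
by case: n => k; rewrite /wexp nat_exp // pres_wordV expVgn.
Qed.

Lemma pres_word_exp_conjV u v c n :
  (pres_word v = (pres_word u)^-1 ^ c)%g ->
  (pres_word (wexp v n) = (pres_word (wexp u n))^-1 ^ c)%g.
Proof.
by move=> vE; rewrite !pres_word_exp vE; case: n => k;
   rewrite -conjXg expVgn ?conjVg ?invgK.
Qed.

End Presentation.

Section NaturalSurjection.
Variables (X : choiceType) (R S : seq (word X * word X)).

(* The natural surjection < X | R > ->> < X | R, S >. *)
Definition pres_surj (g : pres_group R) : pres_group (R ++ S) :=
  pres_word (R ++ S) (pres_repr g).

Lemma pres_eq_surj u v : pres_eq R u v -> pres_eq (R ++ S) u v.
Proof.
elim=> {u v} [u|u v _|v u t _ IH1 _|u u' v v' _ IH1 _|x e|r rR].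
- exact: pres_eq_refl.
- exact: pres_eq_sym.
- exact: pres_eq_trans IH1.
- exact: pres_eq_cat IH1.
- exact: pres_eq_cancel.
- by apply: pres_eq_rel; rewrite mem_cat rR.
Qed.

Lemma pres_surj_word u : pres_surj (pres_word R u) = pres_word (R ++ S) u.
Proof. exact/pres_wordP/pres_eq_surj/pres_repr_word. Qed.

Lemma pres_surjM : {morph pres_surj : g h / (g * h)%g}.
Proof.
move=> g h; rewrite -(pres_reprK g) -(pres_reprK h).
by rewrite -pres_wordM !pres_surj_word pres_wordM.
Qed.

HB.instance Definition _ :=
  isMultiplicative.Build (pres_group R) (pres_group (R ++ S)) pres_surj
    pres_surjM.

Lemma pres_surj_surjective h : exists g, pres_surj g = h.
Proof.
by exists (pres_word R (pres_repr h)); rewrite pres_surj_word pres_reprK.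
Qed.

End NaturalSurjection.

Definition wa : word bool := wgen false.
Definition wb : word bool := wgen true.

Definition tw_w : word bool := wa ++ winv wb ++ winv wa ++ wb.
Definition tw_wbar : word bool := wb ++ winv wa ++ winv wb ++ wa.

Definition twist_rels (n : int) : seq (word bool * word bool) :=
  [:: (wa ++ wexp tw_w n, wexp tw_w n ++ wb)].

Definition twist_group (n : int) := pres_group (twist_rels n).
HB.instance Definition _ n := Group.on (twist_group n).

Definition tw_a (n : int) : twist_group n := pres_word (twist_rels n) wa.
Definition tw_b (n : int) : twist_group n := pres_word (twist_rels n) wb.

(* In the group, w^-n a w^n = b = wbar^n a wbar^-n; hence w^n wbar^n commutes
   with a, whereas wbar^n w^n commutes with b and is the longitude of b. *)
Definition tw_longitude (n : int) : word bool :=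
  wexp tw_w n ++ wexp tw_wbar n.

Section TwistAux.
Local Open Scope group_scope.

Lemma tw_commute_aux (G : groupType) (a b P : G) :
  (a * P = P * b) -> commute P (a * b^-1 * a^-1 * b) ->
  (b * (P^-1 ^ (a * b^-1)) = (P^-1 ^ (a * b^-1)) * a).
Proof.
move=> aP Pw.
have Pa : P^-1 * a = b * P^-1.
  by apply: (mulgI P); rewrite mulVKg mulgA -aP mulgK.
have wV : (a * b^-1 * a^-1 * b)^-1 = b^-1 * a * b * a^-1.
  by rewrite !invgM !invgK !mulgA.
have PwV : b^-1 * a * b * a^-1 * P^-1 = P^-1 * (b^-1 * a * b * a^-1).
  by rewrite -wV; apply/commuteV/commute_sym/commuteV.
have QE : P^-1 ^ (a * b^-1) = b * a^-1 * b * P^-1 * b^-1.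
  by rewrite conjgE invgM invgK (mulgA P^-1) Pa !mulgA.
have E : b * a^-1 * b * P^-1 * b = a^-1 * b * P^-1 * b^-1 * a * b * b.
  apply: (mulgI (b^-1 * a)); rewrite !mulgA mulgK mulVg mul1g.
  have -> : b^-1 * a * b * a^-1 * b * P^-1 = P^-1 * b^-1 * a * b.
    by rewrite -(mulgA _ b) -Pa mulgA PwV !mulgA mulgVK.
  by [].
rewrite QE; apply: (mulIg b); apply: (mulIg b); rewrite mulgA mulgVK.
by rewrite -!mulgA in E *; rewrite E.
Qed.

End TwistAux.

Lemma tw_longitude_commute (n : int) :
  commute (tw_a n) (pres_word (twist_rels n) (tw_longitude n)).
Proof.
set a := tw_a n; set b := tw_b n; set cl := pres_word (twist_rels n).
pose P := cl (wexp tw_w n); pose Q := cl (wexp tw_wbar n).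
have aP : (a * P = P * b)%g.
  rewrite /a /b /P /cl /tw_a /tw_b -!pres_wordM; apply/pres_wordP.
  exact: (@pres_eq_rel _ _ (wa ++ wexp tw_w n, wexp tw_w n ++ wb))
    (mem_head _ _).
have wE : cl tw_w = (a * (b^-1 * (a^-1 * b)))%g.
  by rewrite /cl /tw_w !pres_wordM !pres_wordV.
have wbarE : cl tw_wbar = (b * (a^-1 * (b^-1 * a)))%g.
  by rewrite /cl /tw_wbar !pres_wordM !pres_wordV.
have Pw : commute P (cl tw_w).
  rewrite /P /cl pres_word_exp; case: n {a b cl P Q aP wE wbarE} => k.
    exact/commute_sym/commuteX.
  exact/commute_sym/commuteV/commuteX.
have QE : Q = (P^-1 ^ (a * b^-1))%g.
  have wV : ((cl tw_w)^-1 ^ (a * b^-1))%g = cl tw_wbar.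
    rewrite wE wbarE conjgE !invgM !invgK.
    by rewrite !mulgA mulgVK mulgK.
  by apply: pres_word_exp_conjV; rewrite -/cl wV.
have bQ : (b * Q = Q * a)%g.
  rewrite QE; apply: tw_commute_aux => //.
  by rewrite -!mulgA -wE.
by rewrite /commute /cl pres_wordM -/cl -/P -/Q mulgA aP -mulgA bQ mulgA.
Qed.

Definition surgery_rels (n p : int) : seq (word bool * word bool) :=
  [:: (wexp wa p ++ tw_longitude n, [::])].

Definition surgery_group (n p : int) :=
  pres_group (twist_rels n ++ surgery_rels n p).
HB.instance Definition _ n p := Group.on (surgery_group n p).

Definition surgery_surj (n p : int) : twist_group n -> surgery_group n p :=
  @pres_surj bool (twist_rels n) (surgery_rels n p).

HB.instance Definition _ n p :=
  isMultiplicative.Build (twist_group n) (surgery_group n p)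
    (@surgery_surj n p) (@pres_surjM _ _ _).

Section SpecialLinear.
Variable K : comUnitRingType.
Local Open Scope ring_scope.

Record SL2 := MkSL2 { SL2val :> 'M[K]_2; _ : \det SL2val == 1 }.
HB.instance Definition _ := [isSub for SL2val].
HB.instance Definition _ := [Choice of SL2 by <:].

Lemma SL2_det (A : SL2) : \det A = 1.
Proof. by apply/eqP; case: A. Qed.

Lemma SL2_unit (A : SL2) : (A : 'M[K]_2) \in unitmx.
Proof. by rewrite unitmxE SL2_det unitr1. Qed.

Lemma SL2_one_subproof : \det (1%:M : 'M[K]_2) == 1.
Proof. by rewrite det1. Qed.

Lemma SL2_mul_subproof (A B : SL2) : \det (A *m B) == 1.
Proof. by rewrite det_mulmx !SL2_det mul1r. Qed.

Lemma SL2_inv_subproof (A : SL2) : \det (invmx A) == 1.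
Proof. by rewrite det_inv SL2_det invr1. Qed.

Definition SL2_one := MkSL2 SL2_one_subproof.
Definition SL2_mul A B := MkSL2 (SL2_mul_subproof A B).
Definition SL2_inv A := MkSL2 (SL2_inv_subproof A).

Lemma SL2_mulA : associative SL2_mul.
Proof. by move=> A B C; apply/val_inj; rewrite /= mulmxA. Qed.

Lemma SL2_mul1 : left_id SL2_one SL2_mul.
Proof. by move=> A; apply/val_inj; rewrite /= mul1mx. Qed.

Lemma SL2_mulr1 : right_id SL2_one SL2_mul.
Proof. by move=> A; apply/val_inj; rewrite /= mulmx1. Qed.

Lemma SL2_mulV : left_inverse SL2_one SL2_inv SL2_mul.
Proof. by move=> A; apply/val_inj; rewrite /= mulVmx ?SL2_unit. Qed.

Lemma SL2_mulrV : right_inverse SL2_one SL2_inv SL2_mul.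
Proof. by move=> A; apply/val_inj; rewrite /= mulmxV ?SL2_unit. Qed.

HB.instance Definition _ := isGroup.Build SL2
  SL2_mulA SL2_mul1 SL2_mulr1 SL2_mulV SL2_mulrV.

End SpecialLinear.

Definition irreducible_rep (G : groupType) (K : fieldType)
    (rho : {multiplicative G -> SL2 K}) : Prop :=
  forall U : {vspace 'cV[K]_2},
    (forall (g : G) (v : 'cV[K]_2), v \in U -> (rho g *m v)%R \in U) ->
    U = 0%VS \/ U = fullv.

Definition factors_through (G H L : groupType) (pi : G -> H)
    (rho : {multiplicative G -> L}) : Prop :=
  exists rho' : {multiplicative H -> L}, forall g : G, rho g = rho' (pi g).

(* Main.v *)
(* Write x = tr A and y = tr (A B) for A = rho(a), B = rho(b), and W, V for the
   images of w, wbar, which have the same trace. By Cayley-Hamilton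
   W^n = s W + t and V^n = s V + t for the same scalars s, t. Since
   A W - W B = (y - 1) (A - B) and A != B by irreducibility, the relation
   a w^n = w^n b forces t = - s (y - 1), and det (W^n) = 1 then determines s^2.
   So the longitude s^2 (W - (y - 1)) (V - (y - 1)) is an explicit combination
   of 1 and A with coefficients in Z(x, y) independent of n, and it remains to
   compare it with A^3. *)
Require Import Defs.
From HB Require Import structures.
From mathcomp Require Import all_boot all_order all_algebra.
From mathcomp Require Import boolp reals complex.
From mathcomp Require Import spectral ring.

Set Implicit Arguments.
Unset Strict Implicit.
Unset Printing Implicit Defensive.

Import Order.TTheory GRing.Theory Num.Theory.

(** * Cayley-Hamilton calculus for 2 by 2 matrices *)

Section Mx2.
Variable K : comUnitRingType.
Implicit Types A B : 'M[K]_2.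
Local Open Scope ring_scope.

Let ord2P (P : 'I_2 -> Prop) : P 0 -> P 1 -> forall i, P i.
Proof.
by move=> P0 P1 [[|[|//]] lti];
  [have -> : Ordinal lti = 0 | have -> : Ordinal lti = 1]; try exact: val_inj.
Qed.

Lemma mxtrace2 A : \tr A = A 0 0 + A 1 1.
Proof.
rewrite /mxtrace !big_ord_recl big_ord0 addr0.
by congr (_ + A _ _); apply: val_inj.
Qed.

Lemma det2 A : \det A = A 0 0 * A 1 1 - A 0 1 * A 1 0.
Proof.
have E i : lift ord0 i = 1 :> 'I_2 by case: i => -[|//] lti; apply: val_inj.
have F i : lift 1 i = 0 :> 'I_2 by case: i => -[|//] lti; apply: val_inj.
rewrite (expand_det_row _ 0) !big_ord_recl big_ord0 /cofactor !det_mx11 !mxE.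
rewrite !E !F /= expr0 mul1r expr1; ring.
Qed.

Lemma mulmx2 A B i j : (A *m B) i j = A i 0 * B 0 j + A i 1 * B 1 j.
Proof.
rewrite mxE !big_ord_recl big_ord0 addr0.
by congr (_ + A _ _ * B _ _); apply: val_inj.
Qed.

(** Polarization of Cayley-Hamilton: it moves [B] past [A] and thus keeps products in the span of
    [1], [A], [B], [A B]. *)
Lemma mulmx2_polar A B :
  B *m A = - (A *m B) + \tr B *: A + \tr A *: B
           + (\tr (A *m B) - \tr A * \tr B)%:M.
Proof.
rewrite !mxtrace2; apply/matrixP; elim/ord2P; elim/ord2P;
  rewrite !(mulmx2, mxE) /=; ring.
Qed.

Lemma mulmx2_sqr A : A *m A = \tr A *: A - (\det A)%:M.
Proof.
rewrite mxtrace2 det2; apply/matrixP; elim/ord2P; elim/ord2P;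
  rewrite !(mulmx2, mxE) /=; ring.
Qed.

Lemma det_scale_add2 s t A :
  \det (s *: A + t%:M) = s ^+ 2 * \det A + s * t * \tr A + t ^+ 2.
Proof. by rewrite mxtrace2 !det2 !mxE /=; ring. Qed.

Lemma invmx2 A : \det A = 1 -> invmx A = (\tr A)%:M - A.
Proof.
move=> dA; have uA : A \in unitmx by rewrite unitmxE dA unitr1.
rewrite -[RHS](mulKmx uA) mulmxBr mul_mx_scalar mulmx2_sqr dA.
by rewrite opprB addrC subrK mulmx1.
Qed.

(** In determinant 1 the Cayley-Hamilton recursion depends on the trace alone, so [W] and [V] share
    the same coefficients. The [match] mirrors [pres_word_exp]. *)
Lemma SL2_expz_linear (W V : SL2 K) (n : int) : \tr W = \tr V ->
  exists s t : K,
    let expz (U : SL2 K) := match n with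
      | Posz k => (U ^+ k)%g | Negz k => (U ^- k.+1)%g end in
    (expz W : 'M_2) = s *: (W : 'M_2) + t%:M /\
    (expz V : 'M_2) = s *: (V : 'M_2) + t%:M.
Proof.
have nat_exp (U U' : SL2 K) (k : nat) : \tr U = \tr U' -> exists s t : K,
    ((U ^+ k)%g : 'M_2) = s *: (U : 'M_2) + t%:M /\
    ((U' ^+ k)%g : 'M_2) = s *: (U' : 'M_2) + t%:M.
  move=> trE; elim: k => [|k [s [t [E E']]]].
    by exists 0, 1; rewrite !scale0r !add0r.
  (* Read off from [U (s U + t)] with [U^2 = (\tr U) U - 1]. *)
  exists (s * \tr U + t), (- s); rewrite !expgS.
  have step (M : SL2 K) : (M : 'M_2) *m (s *: (M : 'M_2) + t%:M) =
      (s * \tr M + t) *: (M : 'M_2) + (- s)%:M.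
    rewrite mulmxDr -scalemxAr mulmx2_sqr SL2_det mul_mx_scalar.
    by apply/matrixP => i j; rewrite !mxE; ring.
  by split; [rewrite -step -E | rewrite trE -step -E'].
move=> trE; case: n => k; first exact: nat_exp.
have invE (M : SL2 K) : ((M^-1)%g : 'M_2) = (\tr M)%:M - (M : 'M_2).
  by rewrite -invmx2 ?SL2_det.
have trV : \tr (W^-1)%g = \tr (V^-1)%g.
  by rewrite !invE !raddfB /= !mxtrace_scalar trE.
have [s [t [E E']]] := nat_exp _ _ k.+1 trV.
rewrite expVgn invE in E; rewrite expVgn invE in E'.
(* Obtained by substituting [W^-1 = \tr W - W] in [s W^-1 + t]. *)
exists (- s), (s * \tr W + t); split; rewrite ?E ?E' trE;
  by apply/matrixP => i j; rewrite !mxE; ring.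
Qed.

End Mx2.

(* The span of 1, A, B, A B is closed under multiplication, so matrix words in
   A and B reduce to commutative computations on their four coordinates. *)
Section Quaternion.
Variable K : comUnitRingType.
Variables (A B : SL2 K) (x y : K).
Local Open Scope ring_scope.
Hypotheses (trA : \tr A = x) (trB : \tr B = x) (trAB : \tr (A *m B) = y).

Definition quat (c0 c1 c2 c3 : K) : 'M[K]_2 :=
  c0%:M + c1 *: (A : 'M_2) + c2 *: (B : 'M_2) + c3 *: (A *m B).

(** The products to reduce are [A^2], [B A] and [A B A]; polarization of [B A] turns the last one
    into [y A + B - x]. *)
Lemma quat_mulA c0 c1 c2 c3 : quat c0 c1 c2 c3 *m A =
  quat (- c1 + (y - x ^+ 2) * c2 - x * c3)
       (c0 + x * c1 + x * c2 + y * c3) (x * c2 + c3) (- c2).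
Proof.
have AA : A *m A = x *: (A : 'M_2) - 1%:M by rewrite mulmx2_sqr SL2_det trA.
have BA := mulmx2_polar A B; rewrite trA trB trAB in BA.
have ABA : A *m B *m A = y *: (A : 'M_2) + (B : 'M_2) - x%:M.
  rewrite -mulmxA BA !mulmxDr mulmxN mulmxA AA mul_mx_scalar -!scalemxAr AA.
  rewrite mulmxBl mul1mx -scalemxAl.
  by apply/matrixP => i j; rewrite !mxE; ring.
rewrite /quat !mulmxDl -!scalemxAl ABA BA AA mul_scalar_mx.
by apply/matrixP => i j; rewrite [LHS]mxE !mxE; ring.
Qed.

Lemma quat_mulB c0 c1 c2 c3 : quat c0 c1 c2 c3 *m B =
  quat (- c2) (- c3) (c0 + x * c2) (c1 + x * c3).
Proof.
have BB : B *m B = x *: (B : 'M_2) - 1%:M by rewrite mulmx2_sqr SL2_det trB.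
rewrite /quat !mulmxDl -!scalemxAl -mulmxA BB mulmxBr mulmx1 -scalemxAr.
rewrite mul_scalar_mx.
by apply/matrixP => i j; rewrite !mxE; ring.
Qed.

Lemma quat_mulAV c0 c1 c2 c3 : quat c0 c1 c2 c3 *m invmx A =
  quat (x * c0 + c1 - (y - x ^+ 2) * c2 + x * c3)
       (- c0 - x * c2 - y * c3) (- c3) (c2 + x * c3).
Proof.
rewrite invmx2 ?SL2_det // trA mulmxBr quat_mulA mul_mx_scalar /quat.
by apply/matrixP => i j; rewrite !mxE; ring.
Qed.

Lemma quat_mulBV c0 c1 c2 c3 : quat c0 c1 c2 c3 *m invmx B =
  quat (x * c0 + c2) (x * c1 + c3) (- c0) (- c1).
Proof.
rewrite invmx2 ?SL2_det // trB mulmxBr quat_mulB mul_mx_scalar /quat.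
by apply/matrixP => i j; rewrite !mxE; ring.
Qed.

Definition quatE := (quat_mulA, quat_mulB, quat_mulAV, quat_mulBV).

End Quaternion.

(** * The Riley equation and the longitude in trace coordinates *)

Section TwistKnotMatrices.
Variable K : fieldType.
Variables (A B : SL2 K) (x y : K).
Local Open Scope ring_scope.
Hypotheses (trA : \tr A = x) (trB : \tr B = x) (trAB : \tr (A *m B) = y).

Let W : SL2 K := (A * (B^-1 * (A^-1 * B)))%g.
Let V : SL2 K := (B * (A^-1 * (B^-1 * A)))%g.
Local Notation quat := (quat A B).

(** The free left factor [M] lets the word be absorbed letter by letter from the right, the shape of
    the rules in [quatE]. *)
Let mulW (M : 'M[K]_2) : M *m W = M *m A *m invmx B *m invmx A *m B.
Proof. by rewrite /W /= !mulmxA. Qed.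

Let mulV (M : 'M[K]_2) : M *m V = M *m B *m invmx A *m invmx B *m A.
Proof. by rewrite /V /= !mulmxA. Qed.

Let quat1 : 1%:M = quat 1 0 0 0.
Proof. by rewrite /quat !scale0r !addr0. Qed.

Let quatA : A = quat 0 1 0 0 :> 'M_2.
Proof. by rewrite /quat !scale0r scale1r !addr0 raddf0 add0r. Qed.

Lemma mxtrace_quat c0 c1 c2 c3 :
  \tr (quat c0 c1 c2 c3) = 2 * c0 + x * c1 + x * c2 + y * c3.
Proof.
rewrite /quat !raddfD /= !mxtraceZ mxtrace_scalar trA trB trAB -mulr_natl.
ring.
Qed.

Let WE : W = quat (- 1) x x (y - x ^+ 2) :> 'M_2.
Proof.
rewrite -[LHS]mul1mx mulW quat1 !(quatE trA trB trAB); congr quat; ring.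
Qed.

Let VE : V = quat ((x ^+ 2 - y) ^+ 2 - 1) (x * (1 + y - x ^+ 2))
  (x * (1 + y - x ^+ 2)) (x ^+ 2 - y) :> 'M_2.
Proof.
rewrite -[LHS]mul1mx mulV quat1 !(quatE trA trB trAB); congr quat; ring.
Qed.

Lemma mxtrace_comm_word : \tr W = y ^+ 2 - x ^+ 2 * y + 2 * x ^+ 2 - 2.
Proof. by rewrite WE mxtrace_quat; ring. Qed.

Lemma mxtrace_comm_word_rev : \tr W = \tr V.
Proof. by rewrite WE VE !mxtrace_quat; ring. Qed.

(** With [1] in place of [W] the left side is [A - B]. Hence [A P - P B] is a multiple of [A - B]
    for every [P] in the span of [1] and [W]. *)
Lemma mul_comm_wordB :
  A *m W - W *m B = (y - 1) *: ((A : 'M_2) - (B : 'M_2)).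
Proof.
rewrite mulW {1}quatA WE !(quatE trA trB trAB) /quat.
by apply/matrixP => i j; rewrite !mxE; ring.
Qed.

Variables (s t : K) (P Q : SL2 K).
Hypotheses (PE : P = s *: (W : 'M_2) + t%:M :> 'M_2)
           (QE : Q = s *: (V : 'M_2) + t%:M :> 'M_2)
           (AP : A *m P = P *m B) (neqAB : (A : 'M_2) != B).

Lemma riley_eq : t = - (s * (y - 1)).
Proof.
have : (s * (y - 1) + t) *: ((A : 'M_2) - (B : 'M_2)) = 0.
  rewrite scalerDl -scalerA -mul_comm_wordB.
  move/eqP: AP; rewrite -subr_eq0 PE mulmxDr mulmxDl -scalemxAr -scalemxAl.
  rewrite mul_mx_scalar mul_scalar_mx => /eqP <-.
  by rewrite !scalerBr opprD addrACA.
move/eqP; rewrite scaler_eq0 subr_eq0 (negPf neqAB) orbF.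
by rewrite addr_eq0 => /eqP ->; rewrite opprK.
Qed.

(** This is [\det P = 1] after eliminating [t]. It also shows that neither [s] nor [y - 2]
    vanishes. *)
Lemma riley_det : s ^+ 2 * ((y - 2) * (x ^+ 2 * (y - 1) - y ^+ 2)) = 1.
Proof.
have := SL2_det P; rewrite PE det_scale_add2 SL2_det mxtrace_comm_word riley_eq.
by move=> detP; rewrite -[RHS]detP; ring.
Qed.

(** The coordinates along [B] and [A B] cancel, as expected since the longitude commutes with the
    meridian [a]. *)
Lemma longitudeE : P *m Q = (s ^+ 2 * (y - 2)) *:
  ((x ^+ 2 * (2 * y + 1) - x ^+ 4 - y ^+ 2)%:M +
   (x * (x ^+ 4 - 2 * x ^+ 2 * (y + 1) + y * (y + 2))) *: (A : 'M_2)).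
Proof.
have -> : P = quat (t - s) (s * x) (s * x) (s * (y - x ^+ 2)) :> 'M_2.
  by rewrite PE WE /quat; apply/matrixP => i j; rewrite !mxE; ring.
rewrite QE mulmxDr -scalemxAr mulV !(quatE trA trB trAB) mul_mx_scalar.
by rewrite riley_eq /quat; apply/matrixP => i j; rewrite !mxE; ring.
Qed.

(** The difference of the two sides has the factor [y - x]. For the converse, the cofactor
    [q0 + q1 A] must be shown nonzero when [x] and [y] differ. *)
Lemma longitude_eq_cube : x = y <-> P *m Q = A *m A *m A.
Proof.
have cubeE : A *m A *m A = (- x)%:M + (x ^+ 2 - 1) *: (A : 'M_2).
  rewrite mulmx2_sqr SL2_det trA mulmxBl mul1mx -scalemxAl mulmx2_sqr.
  by rewrite SL2_det trA; apply/matrixP => i j; rewrite !mxE; ring.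
have diffE : P *m Q - A *m A *m A = (s ^+ 2 * (y - 2) * (y - x)) *:
    ((x ^+ 3 + x ^+ 2 - x - (1 + x) * y)%:M +
     ((x ^+ 2 + x - 1) * y - x ^+ 4 - x ^+ 3 + 2 * x ^+ 2 + x) *: (A : 'M_2)).
  (* The cube is multiplied by [1], written as in [riley_det], so that both terms acquire the factor
     [s^2 (y - 2)]. *)
  rewrite longitudeE cubeE -[X in _ - X]scale1r.
  rewrite -[X in _ - X *: _]riley_det.
  by apply/matrixP => i j; rewrite !mxE; ring.
split=> [xy|/eqP].
  by apply/eqP; rewrite -subr_eq0 diffE xy subrr mulr0 scale0r.
have [s0 y2] : s != 0 /\ y - 2 != 0.
  by split; apply/eqP => z0; move: riley_det; rewrite z0 => /eqP;
    rewrite ?expr0n /= ?mul0r ?mulr0 eq_sym oner_eq0.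
rewrite -subr_eq0 diffE scaler_eq0 !mulf_eq0 ?expf_eq0 /= (negPf s0) (negPf y2).
rewrite /= subr_eq0 eq_sym; have [//|nxy /= /eqP] := eqVneq x y.
set q0 := (X in X%:M + _); set q1 := (X in _ + X *: _) => q0q1.
have uP := SL2_unit P.
(* Otherwise [A] is scalar, hence commutes with [P], and [A P = P B] gives [A = B]. *)
have q10 : q1 = 0.
  apply/eqP; apply: contraNT neqAB => nq1; apply/eqP.
  have AE : (A : 'M_2) = (- (q0 / q1))%:M.
    apply: (scalerI nq1); apply/eqP; rewrite -subr_eq0 -q0q1; apply/eqP.
    by apply/matrixP => i j; rewrite !mxE; field.
  rewrite -[RHS](mulKmx uP) -AP [in RHS]AE mul_scalar_mx -mul_mx_scalar.
  by rewrite mulKmx // -AE.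
have q00 : q0 = 0.
  move: q0q1; rewrite q10 scale0r addr0 => /matrixP/(_ 0 0).
  by rewrite !mxE.
(* Eliminating y from q0 = q1 = 0 leaves x (x + 2) = 0, whose two roots give
   y = 0 = x and y = 2 respectively. *)
have : x * (x + 2) = 0.
  transitivity ((x ^+ 2 + x - 1) * q0 + (1 + x) * q1); last first.
    by rewrite q00 q10 !mulr0 addr0.
  by rewrite /q0 /q1; ring.
move/eqP; rewrite mulf_eq0 addr_eq0 => /orP[]/eqP xE.
  case/eqP: nxy; apply/eqP; rewrite -subr_eq0 -[X in _ == X]q00.
  by apply/eqP; rewrite /q0 xE; ring.
case/eqP: y2; rewrite -[RHS]q00 /q0 xE; ring.
Qed.

End TwistKnotMatrices.

(** * Morphisms out of presented groups *)

Section GroupTheory.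
Local Open Scope group_scope.

(* The library states these for UMagmaMorphism.type only, and multiplicative
   maps between groups do not coerce to it. *)
Section GroupMorphism.
Variables (G H : groupType) (f : {multiplicative G -> H}).

Lemma multiplicative1 : f 1 = 1.
Proof. by apply: (mulgI (f 1)); rewrite -gmulfM !mulg1. Qed.

Lemma multiplicativeV : {morph f : g / g^-1}.
Proof.
by move=> g; apply: (mulgI (f g)); rewrite -gmulfM !mulgV multiplicative1.
Qed.

Lemma multiplicativeX k : {morph f : g / g ^+ k}.
Proof.
move=> g; elim: k => [|k IH]; first exact: multiplicative1.
by rewrite !expgS gmulfM IH.
Qed.

End GroupMorphism.

Lemma multiplicative_wexp (X : choiceType) (R : seq (word X * word X))
    (L : groupType) (rho : {multiplicative pres_group R -> L}) u n :
  rho (pres_word R (wexp u n)) = match n with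
    | Posz k => rho (pres_word R u) ^+ k
    | Negz k => rho (pres_word R u) ^- k.+1
  end.
Proof.
by rewrite pres_word_exp; case: n => k;
  rewrite ?multiplicativeV multiplicativeX.
Qed.

(** Universal property of the quotient: the induced map evaluates [rho] on a chosen representative,
    and induction on derivations ([rho_eq]) shows that the choice does not matter. *)
Lemma factors_through_pres (X : choiceType) (R S : seq (word X * word X))
    (L : groupType) (rho : {multiplicative pres_group R -> L}) :
  factors_through (@pres_surj X R S) rho <->
  (forall r, r \in S -> rho (pres_word R r.1) = rho (pres_word R r.2)).
Proof.
split=> [[rho' rhoE] r rS | rhoS].
  rewrite !rhoE !pres_surj_word; congr (rho' _); apply/pres_wordP.
  by apply: pres_eq_rel; rewrite mem_cat rS orbT.
have rho_eq u v : pres_eq (R ++ S) u v ->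
    rho (pres_word R u) = rho (pres_word R v).
  elim=> {u v} [|u v _ ->|v u t _ -> _ ->|u u' v v' _ E _ E'|z e|r] //.
  - by rewrite !pres_wordM !gmulfM E E'.
  - by congr (rho _); apply/pres_wordP/pres_eq_cancel.
  - rewrite mem_cat => /orP[rR|/rhoS //].
    by congr (rho _); apply/pres_wordP/pres_eq_rel.
pose f (h : pres_group (R ++ S)) := rho (pres_word R (pres_repr h)).
have fE u : f (pres_word (R ++ S) u) = rho (pres_word R u).
  exact/rho_eq/pres_repr_word.
have fM : {morph f : g h / g * h}.
  move=> g h; rewrite -(pres_reprK g) -(pres_reprK h) -pres_wordM !fE.
  by rewrite pres_wordM gmulfM.
pose F := isMultiplicative.Build _ _ f fM.
exists (HB.pack_for {multiplicative pres_group (R ++ S) -> L} f F) => g /=.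
by rewrite -(pres_reprK g) pres_surj_word fE.
Qed.

End GroupTheory.

(** * Irreducibility separates the images of the two meridians *)

Section IrreducibleRep.
Local Open Scope ring_scope.

(** If both generators had the same image, an eigenvector of it would span an invariant line. *)
Lemma irreducible_rep_neq (C : numClosedFieldType) (n : int)
    (rho : {multiplicative twist_group n -> SL2 C}) :
  irreducible_rep rho -> (rho (tw_a n) : 'M_2) != rho (tw_b n).
Proof.
move=> irr; apply/eqP=> AB; set A : 'M_2 := rho (tw_a n) in AB.
(* [eigenvalueP] yields row vectors; transposing [A] produces a column eigenvector. *)
have [c /eigenvalueP [u uA u0]] := eigenvalue_closed A^T (ltn0Sn 1).
pose v := u^T.
have Av : A *m v = c *: v by rewrite -[A]trmxK -trmx_mul uA linearZ.
have v0 : v != 0 by apply: contra u0 => /eqP v0; rewrite -[u]trmxK -/v v0 trmx0.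
have uniA : A \in unitmx by exact: SL2_unit.
have c0 : c != 0.
  apply: contra v0 => /eqP c0.
  by rewrite -[v](mulKmx uniA) Av c0 scale0r mulmx0.
have AVv : invmx A *m v = c^-1 *: v.
  by rewrite -[v in LHS](scalerK c0) -scalemxAr -Av mulKmx.
have rho1 : rho (pres_word _ [::]) = 1%g by exact: multiplicative1.
(* Induction on a word representing [g]: each letter scales [v] by [c] or [c^-1]. *)
have stab (g : twist_group n) : exists d : C, rho g *m v = d *: v.
  rewrite -(pres_reprK g); elim: (pres_repr g) => [|[l e] w [d IH]].
    by exists 1; rewrite rho1 mul1mx scale1r.
  rewrite -cat1s pres_wordM gmulfM /= -mulmxA IH -scalemxAr.
  have [d' ->] : exists d',
      rho (pres_word (twist_rels n) [:: (l, e)]) *m v = d' *: v.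
    case: e.
      have -> : [:: (l, true)] = winv (wgen l) by [].
      rewrite pres_wordV multiplicativeV /=; exists c^-1.
      by case: l; rewrite -AVv // AB.
    by exists c; case: l; rewrite -Av // AB.
  by exists (d * d'); rewrite scalerA.
have stabU (g : twist_group n) (w : 'cV[C]_2) :
    w \in <[v]>%VS -> rho g *m w \in <[v]>%VS.
  move=> /vlineP [k ->]; have [d gv] := stab g.
  by rewrite -scalemxAr gv scalerA memvZ // memv_line.
have [U0|Uf] := irr _ stabU.
- by move/eqP: v0; apply; apply/eqP; rewrite -memv0 -U0 memv_line.
- by have := dim_vline v; rewrite Uf dimvf /dim /= v0.
Qed.

End IrreducibleRep.

Theorem theoremC (R : realType) (n : int)
    (rho : {multiplicative twist_group n -> SL2 R[i]})
    (irr : irreducible_rep rho) :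
  (\tr (rho (tw_a n)) = \tr (rho (tw_a n * tw_b n)%g))%R <->
  factors_through (@surgery_surj n (-3)%R) rho.
Proof.
set A := rho (tw_a n); set B := rho (tw_b n).
pose cl := pres_word (twist_rels n).
have neqAB := irreducible_rep_neq irr.
have wE : rho (cl tw_w) = (A * (B^-1 * (A^-1 * B)))%g.
  by rewrite /cl /tw_w !pres_wordM !pres_wordV !gmulfM !multiplicativeV.
have wbarE : rho (cl tw_wbar) = (B * (A^-1 * (B^-1 * A)))%g.
  by rewrite /cl /tw_wbar !pres_wordM !pres_wordV !gmulfM !multiplicativeV.
pose P := rho (cl (wexp tw_w n)); pose Q := rho (cl (wexp tw_wbar n)).
have AP : (A * P = P * B)%g.
  rewrite -!gmulfM -!pres_wordM; congr (rho _); apply/pres_wordP.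
  exact: (@pres_eq_rel _ _ (wa ++ wexp tw_w n, wexp tw_w n ++ wb))
    (mem_head _ _).
(* The knot relation makes [A] and [B] conjugate, hence of equal trace. *)
have BE : (rho (tw_b n) : 'M_2) = (invmx P *m A *m P)%R.
  by rewrite -mulmxA (congr1 val AP : A *m P = P *m B)%R mulKmx // SL2_unit.
have trAB : (\tr A = \tr B :> R[i])%R.
  by rewrite [in RHS]BE mxtrace_mulC mulmxA mulmxV ?SL2_unit // mul1mx.
have [s [t [PE QE]]] := SL2_expz_linear n
  (mxtrace_comm_word_rev erefl (esym trAB) erefl).
rewrite -wE -wbarE -!multiplicative_wexp wE wbarE in PE QE.
rewrite gmulfM.
have key := longitude_eq_cube erefl (esym trAB) erefl PE QE
  (congr1 val AP) neqAB.
apply: (iff_trans key); apply: iff_sym.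
apply: (iff_trans (factors_through_pres _ _)).
have relE : rho (cl (wexp wa (-3)%R ++ tw_longitude n)) = (A ^- 3 * (P * Q))%g.
  rewrite /cl pres_wordM gmulfM.
  (* [Negz 2] is [-3], so this power is [A ^- 3] and the surgery relation reads [P Q = A^3]. *)
  rewrite [X in (X * _)%g](multiplicative_wexp rho wa (Negz 2)).
  by rewrite pres_wordM gmulfM.
have rho1 : rho (cl [::]) = 1%g by exact: multiplicative1.
split=> [rel|PQ r].
  have := rel _ (mem_head _ _); rewrite /= relE rho1.
  move/(canRL (mulVKg _))/(congr1 val).
  by rewrite mulg1 !expgS /= mulmx1 mulmxA.
rewrite inE => /eqP -> /=; rewrite relE rho1.
suff -> : (P * Q)%g = (A ^+ 3)%g by rewrite mulVg.
by apply: val_inj; rewrite !expgS /= mulmx1 mulmxA.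
Qed.
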